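(* Let $P_t$ evolve by the Fokker--Planck equation $\partial_t P_t=-\nabla\cdot(\boldsymbol\nu_t P_t)$, $\boldsymbol\nu_t=\mu(\boldsymbol F_t-T\nabla\ln P_t)$ on $\mathbb R^d$, let $\tau$ be a time, $dt>0$ a time step, and let $\mathbb T_\tau(\boldsymbol x_{\tau+dt}\mid\boldsymbol x_\tau)$ and $\mathbb P(\boldsymbol x_{\tau+dt},\boldsymbol x_\tau)=\mathbb T_\tau(\boldsymbol x_{\tau+dt}\mid\boldsymbol x_\tau)P_\tau(\boldsymbol x_\tau)$ be the associated Gaussian short-time transition density and forward path probability density. Let $R(\boldsymbol x_{\tau+dt},\boldsymbol x_\tau)\in\mathbb R$ be any function of $\boldsymbol x_{\tau+dt}\in\mathbb R^d$ and $\boldsymbol x_\tau\in\mathbb R^d$ such that $\mathbb T_\tau(\boldsymbol x_{\tau+dt}\mid\boldsymbol x_\tau)R(\boldsymbol x_{\tau+dt},\boldsymbol x_\tau)\to0$ at infinity of $\boldsymbol x_{\tau+dt}$, and with $\mathrm{Var}[R]>0$. Then the entropy production rate $\sigma_\tau$ satisfies $$\sigma_\tau\,dt\ \ge\ \frac{2\,(\mathcal J[\tilde{\boldsymbol R}])^2}{\mathrm{Var}[R]/dt}\,dt+O(dt^2),$$ where $\mathrm{Var}[R]=\mathbb E_{\mathbb P}\big[(R-\mathbb E_{\mathbb P}[R])^2\big]$ is the variance of $R$ under $\mathbb P$, and $$\mathcal J[\tilde{\boldsymbol R}]=\int d\boldsymbol x_\tau\,\boldsymbol\nu_\tau(\boldsymbol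 x_\tau)\cdot\tilde{\boldsymbol R}(\boldsymbol x_\tau)\,P_\tau(\boldsymbol x_\tau),\qquad \tilde{\boldsymbol R}(\boldsymbol x_\tau)=\int d\boldsymbol x_{\tau+dt}\,\mathbb T_\tau(\boldsymbol x_{\tau+dt}\mid\boldsymbol x_\tau)\,\nabla_{\boldsymbol x_{\tau+dt}}R(\boldsymbol x_{\tau+dt},\boldsymbol x_\tau).$$
   Context: Constants $\mu>0$, $T>0$ and a force field $\boldsymbol F_t:\mathbb R^d\to\mathbb R^d$ are given. $P_t$ is a probability density on $\mathbb R^d$ solving the Fokker--Planck equation $\partial_tP_t(\boldsymbol x)=-\nabla\cdot(\boldsymbol\nu_t(\boldsymbol x)P_t(\boldsymbol x))$ with mean local velocity $\boldsymbol\nu_t(\boldsymbol x)=\mu(\boldsymbol F_t(\boldsymbol x)-T\nabla\ln P_t(\boldsymbol x))$. The entropy production rate is $\sigma_\tau=\frac1{\mu T}\int d\boldsymbol x\,\|\boldsymbol\nu_\tau(\boldsymbol x)\|^2P_\tau(\boldsymbol x)$. The short-time transition density is $$\mathbb T_\tau(\boldsymbol x_{\tau+dt}\mid\boldsymbol x_\tau)=\frac1{(4\pi\mu T\,dt)^{d/2}}\exp\Big[-\frac{\|\boldsymbol x_{\tau+dt}-\boldsymbol x_\tau-\mu\boldsymbol F_\tau(\boldsymbol x_\tau)dt\|^2}{4\mu T\,dt}\Big].$$ $\nabla_{\boldsymbol x_{\tau+dt}}$ is the gradient in the variable $\boldsymbol x_{\tau+dt}$; $\mathbb E_{\mathbb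 P}$ is expectation with respect to $\mathbb P$; $\|\cdot\|$ is the Euclidean norm. $O(dt^2)$ denotes a term with $\lim_{dt\to0}O(dt^2)/dt=0$. Functions are taken smooth and integrable enough that all displayed expressions are defined and finite. *)

(* Defs.v *)
From HB Require Import structures.
From mathcomp Require Import all_boot all_order all_algebra.
From mathcomp Require Import all_classical all_reals all_analysis.

Set Implicit Arguments.
Unset Strict Implicit.
Unset Printing Implicit Defensive.
Import Order.TTheory GRing.Theory Num.Theory.
Import numFieldNormedType.Exports.

Local Open Scope classical_set_scope.
Local Open Scope ring_scope.

Fact measure_rV_display : measure_display. Proof. exact: default_measure_display. Qed.

(* Row vectors carry the sigma-algebra generated by the coordinates, as
   n.-tuple does; it is the Borel sigma-algebra of R^n. *)
Section measurable_rV.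
Variables (R : realType) (n : nat).

Let coors : 'I_n -> 'rV[R]_n -> measurableTypeR R := fun i x => x ord0 i.

Let rV_set0 : g_sigma_preimage coors set0.
Proof. exact: sigma_algebra0. Qed.

Let rV_setC A : g_sigma_preimage coors A -> g_sigma_preimage coors (~` A).
Proof. exact: sigma_algebraC. Qed.

Let rV_bigcup (F : _^nat) : (forall i, g_sigma_preimage coors (F i)) ->
  g_sigma_preimage coors (\bigcup_i (F i)).
Proof. exact: sigma_algebra_bigcup. Qed.

HB.instance Definition _ := @isMeasurable.Build measure_rV_display
  'rV[R]_n (g_sigma_preimage coors) rV_set0 rV_setC rV_bigcup.

Lemma measurable_coord (i : 'I_n) :
  measurable_fun [set: 'rV[R]_n] (fun x => x ord0 i : measurableTypeR R).
Proof.
move=> _ Y mY; rewrite setTI; apply: sub_sigma_algebra => /=.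
rewrite -bigcup_seq/=; exists i => /=; first by rewrite mem_index_enum.
by exists Y => //; rewrite setTI.
Qed.

Lemma measurable_fun_rVP d (T : measurableType d) (f : T -> 'rV[R]_n) :
  measurable_fun [set: T] f <->
  forall i, measurable_fun [set: T] (fun t => f t ord0 i : measurableTypeR R).
Proof.
split=> [mf i|mf].
  exact: (measurableT_comp (measurable_coord i) mf).
apply: (@measurability _ _ _ _ [set: T] f
  (\big[setU/set0]_(i < n) preimage_set_system setT (coors i) measurable)) => //.
move=> _ [C + <-].
rewrite -bigcup_seq => -[i _ [B mB <-]].
by rewrite setTI setTI -comp_preimage -[X in measurable X]setTI; exact: mf.
Qed.

End measurable_rV.

Section lebesgue_rV.
Variable R : realType.
Local Open Scope ereal_scope.

Definition rV_cons n (z : measurableTypeR R * 'rV[R]_n) : 'rV[R]_n.+1 :=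
  row_mx z.1%:M z.2.

Definition rV_uncons n (x : 'rV[R]_n.+1) : measurableTypeR R * 'rV[R]_n :=
  (x ord0 ord0, \row_i x ord0 (lift ord0 i)).

Lemma rV_cons0 n (z : measurableTypeR R * 'rV[R]_n) :
  rV_cons z ord0 ord0 = z.1.
Proof.
rewrite /rV_cons [LHS](_ : _ = row_mx z.1%:M z.2 ord0 (lshift n ord0)).
  by rewrite row_mxEl mxE.
by congr (row_mx _ _ _ _); exact/val_inj.
Qed.

Lemma rV_consS n (z : measurableTypeR R * 'rV[R]_n) i :
  rV_cons z ord0 (lift ord0 i) = z.2 ord0 i.
Proof.
rewrite /rV_cons [LHS](_ : _ = row_mx z.1%:M z.2 ord0 (rshift 1 i)).
  by rewrite row_mxEr.
by congr (row_mx _ _ _ _); exact/val_inj.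
Qed.

Lemma rV_consK n : cancel (@rV_cons n) (@rV_uncons n).
Proof.
move=> [a v]; rewrite /rV_uncons rV_cons0/=; congr pair.
by apply/rowP => i; rewrite mxE rV_consS.
Qed.

Lemma measurable_rV_cons n : measurable_fun [set: _] (@rV_cons n).
Proof.
apply/measurable_fun_rVP => i; case: (unliftP ord0 i) => [j ->|->].
  under eq_fun do rewrite rV_consS.
  exact: (measurableT_comp (measurable_coord j) measurable_snd).
under eq_fun do rewrite rV_cons0.
exact: measurable_fst.
Qed.

Lemma measurable_rV_uncons n : measurable_fun [set: _] (@rV_uncons n).
Proof.
apply: measurable_fun_pair; first exact: measurable_coord.
apply/measurable_fun_rVP => i.
under eq_fun do rewrite mxE.
exact: measurable_coord.
Qed.

Section step.
Variables (n : nat) (m : {sigma_finite_measure set 'rV[R]_n -> \bar R}).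

Definition lebesgue_rV_succ : set 'rV[R]_n.+1 -> \bar R :=
  pushforward (@lebesgue_measure R \x m) (@rV_cons n).

Let succ0 : lebesgue_rV_succ set0 = 0.
Proof. by rewrite /lebesgue_rV_succ /pushforward preimage_set0 measure0. Qed.

Let succ_ge0 A : 0 <= lebesgue_rV_succ A.
Proof. by rewrite /lebesgue_rV_succ /pushforward; exact: measure_ge0. Qed.

Let mpre (A : set 'rV[R]_n.+1) : measurable A ->
  measurable (@rV_cons n @^-1` A).
Proof.
by move=> mA; rewrite -[X in measurable X]setTI; exact: measurable_rV_cons.
Qed.

Let succ_sigma_additive : semi_sigma_additive lebesgue_rV_succ.
Proof.
move=> F mF tF mUF; rewrite /lebesgue_rV_succ /pushforward preimage_bigcup.
apply: measure_semi_sigma_additive => [k||].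
- exact: mpre (mF k).
- apply/trivIsetP => /= i j _ _ ij; rewrite -preimage_setI.
  by move/trivIsetP : tF => /(_ _ _ _ _ ij) ->//; rewrite preimage_set0.
- by rewrite -preimage_bigcup; exact: mpre.
Qed.

HB.instance Definition _ := isMeasure.Build _ _ _
  lebesgue_rV_succ succ0 succ_ge0 succ_sigma_additive.

Let succ_sigma_finite : sigma_finite setT lebesgue_rV_succ.
Proof.
have /sigma_finiteP[F [TF ndF Foo]] := sigma_finiteT (@lebesgue_measure R).
have /sigma_finiteP[G [TG ndG Goo]] := sigma_finiteT m.
exists (fun k => @rV_uncons n @^-1` (F k `*` G k)).
  rewrite -preimage_bigcup [X in _ @^-1` X](_ : _ = setT) ?preimage_setT//.
  rewrite -setXTT TF TG predeqE => -[x y]; split.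
    by move=> [k _ []/= ? ?]; split; exists k.
  move=> [/= [i _ Fix_] [k _ Gky]]; exists (maxn i k) => //; split.
  - by move: x Fix_; exact/subsetPset/ndF/leq_maxl.
  - by move: y Gky; exact/subsetPset/ndG/leq_maxr.
move=> k; have [mF Fk] := Foo k; have [mG Gk] := Goo k; split.
  rewrite -[X in measurable X]setTI; apply: measurable_rV_uncons => //.
  exact: measurableX.
rewrite /lebesgue_rV_succ /pushforward -comp_preimage.
rewrite (_ : _ \o _ = id) ?preimage_id; last exact/funext/rV_consK.
by rewrite product_measure1E// lte_mul_pinfty// ge0_fin_numE.
Qed.

HB.instance Definition _ := Measure_isSigmaFinite.Build _ _ _
  lebesgue_rV_succ succ_sigma_finite.

End step.

(* Identify R^(n+1) with R x R^n through rV_cons; R^0 is a point of mass 1. *)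
Fixpoint lebesgue_rV n : {sigma_finite_measure set 'rV[R]_n -> \bar R} :=
  if n is k.+1 then lebesgue_rV_succ (lebesgue_rV k)
  else dirac (0%R : 'rV[R]_0).

End lebesgue_rV.

Section vector_calculus.
Variables (R : realType) (d : nat).
Implicit Types (x y : 'rV[R]_d) (f : 'rV[R]_d -> R).

Definition dotp x y : R := \sum_i x ord0 i * y ord0 i.

(* The canonical norm `|x| of 'rV[R]_d is the sup norm, hence this one. *)
Definition enorm x : R := Num.sqrt (dotp x x).

Definition grad f x : 'rV[R]_d := \row_i 'D_(delta_mx ord0 i) f x.

Definition divergence (v : 'rV[R]_d -> 'rV[R]_d) x : R :=
  \sum_i 'D_(delta_mx ord0 i) (fun y => v y ord0 i) x.

Definition C1 f := (forall x, differentiable f x) /\ continuous (grad f).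

Definition vanishes_at_infinity f :=
  forall e : R, 0 < e -> exists M : R, forall x, M < enorm x -> `|f x| < e.

Definition rV_integral (v : 'rV[R]_d -> 'rV[R]_d) : 'rV[R]_d :=
  \row_i (\int[lebesgue_rV R d]_x v x ord0 i).

Definition positive_density f :=
  [/\ measurable_fun [set: 'rV[R]_d] f, (forall x, 0 < f x) &
      (\int[lebesgue_rV R d]_x (f x)%:E = 1)%E].

End vector_calculus.

Section fokker_planck.
Variables (R : realType) (d : nat) (mu T : R).
Implicit Types (F : 'rV[R]_d -> 'rV[R]_d) (p : 'rV[R]_d -> R).

Definition mean_velocity F p (x : 'rV[R]_d) : 'rV[R]_d :=
  mu *: (F x - T *: grad (fun y => ln (p y)) x).

Definition flux F p (x : 'rV[R]_d) : 'rV[R]_d :=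
  p x *: mean_velocity F p x.

(* Classical solutions; positivity makes ln (P t) meaningful. *)
Definition fokker_planck_solution (I : set R)
    (F : R -> 'rV[R]_d -> 'rV[R]_d) (P : R -> 'rV[R]_d -> R) :=
  forall t, I t ->
  [/\ positive_density (P t), C1 (P t),
      forall x, differentiable (flux (F t) (P t)) x &
      forall x, is_derive t 1 (fun s => P s x)
                  (- divergence (flux (F t) (P t)) x)].

Definition entropy_production_rate F p : R :=
  (mu * T)^-1 *
  \int[lebesgue_rV R d]_x (enorm (mean_velocity F p x) ^+ 2 * p x).

Definition transition F (dt : R) (x' x : 'rV[R]_d) : R :=
  ((4 * pi * mu * T * dt) `^ (d%:R / 2))^-1 *
  expR (- (enorm (x' - x - (mu * dt) *: F x) ^+ 2 / (4 * mu * T * dt))).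

Definition forward_density F p (dt : R) (z : 'rV[R]_d * 'rV[R]_d) : R :=
  transition F dt z.1 z.2 * p z.2.

Definition path_measure := (lebesgue_rV R d \x lebesgue_rV R d)%E.

Definition path_expectation F p (dt : R) (g : 'rV[R]_d * 'rV[R]_d -> R) : R :=
  \int[path_measure]_z (forward_density F p dt z * g z).

Definition path_variance F p (dt : R) (g : 'rV[R]_d * 'rV[R]_d -> R) : R :=
  path_expectation F p dt (fun z => (g z - path_expectation F p dt g) ^+ 2).

Implicit Type obs : 'rV[R]_d -> 'rV[R]_d -> R.

(* Observables take the final position first, as the transition density. *)
Definition grad_average F (dt : R) obs (x : 'rV[R]_d) : 'rV[R]_d :=
  rV_integral (fun x' => transition F dt x' x *: grad (obs^~ x) x').

Definition generalized_current F p (w : 'rV[R]_d -> 'rV[R]_d) : R :=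
  \int[lebesgue_rV R d]_x (dotp (mean_velocity F p x) (w x) * p x).

End fokker_planck.

Arguments path_measure : clear implicits.

(* Main.v *)
(* Write [s = 2 mu T dt] and let [Z = nu(x) . (x' - x - mu F(x) dt) / s] be the
   score of the path density in the direction of the mean local velocity.
   Integrating by parts in [x'] turns the current into a correlation,
   [J = E[R Z]]; the same identity for [R = 1] gives [E[Z] = 0], and the second
   moments of the Gaussian kernel give [E[Z^2] = sigma / (2 dt)].  Cauchy-Schwarz
   then yields [J^2 <= Var[R] sigma / (2 dt)], so the error term is zero.  The
   boundary terms of the integration by parts vanish for almost every [x]:
   [E[R^2] < oo] makes [x' |-> T(x'|x) R(x',x)^2] integrable there, hence also
   the gradient of [T R]. *)

Require Import Defs.
From HB Require Import structures.
From mathcomp Require Import all_boot all_order all_algebra.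
From mathcomp Require Import all_classical all_reals all_analysis.
From mathcomp Require Import measurable_realfun normal_distribution.
From mathcomp Require Import ring lra.
Import Order.TTheory GRing.Theory Num.Theory.
Import numFieldNormedType.Exports.
Local Open Scope classical_set_scope.
Local Open Scope ring_scope.

Set Implicit Arguments.
Unset Strict Implicit.
Unset Printing Implicit Defensive.

(** * Lebesgue integration over row vectors *)

(** The decay of [T R] at infinity comes without a rate, so it does not control a flux through large
    spheres, whose area grows. The integration by parts therefore goes line by line: Fubini isolates
    one coordinate, and on almost every line parallel to that axis the fundamental theorem of
    calculus only needs the values at the two ends. The price is integrability of the whole partial
    derivative of [T R]. It is the sum of [T] times a partial derivative of [R], integrable by
    hypothesis, and of [- s^-1 T R] times a coordinate of [x' - m], where [m] is the mean of the
    kernel; the latter is dominated by [T R^2] plus a second moment of the kernel.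

    A second obstacle is that no regularity of the force is assumed by itself. Its continuity, hence
    the measurability of the drift and of the score, is recovered from the differentiability of the
    flux. *)

(** The coordinate sigma-algebra contains the Borel sets because boxes with rational centres and
    radii [1 / (k + 1)] form a countable base of the topology. *)
Lemma open_measurable_rV (R : realType) (n : nat) (U : set 'rV[R]_n) :
  open U -> measurable U.
Proof.
move=> oU.
pose box (z : 'rV[rat]_n * nat) : set 'rV[R]_n :=
  \big[setI/setT]_(i < n)
     ((fun x : 'rV[R]_n => x ord0 i : measurableTypeR R) @^-1`
        ball (ratr (z.1 ord0 i) : R) z.2.+1%:R^-1).
have boxE z x : box z x <->
    forall i, `|ratr (z.1 ord0 i) - x ord0 i| < z.2.+1%:R^-1.
  rewrite /box -bigcap_seq /bigcap/=; split=> [+ i|+ i _]; last exact.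
  by apply; rewrite mem_index_enum.
(* Boxes that leave [U] are replaced by the empty set, so that the union runs over a whole countable
   type. *)
have -> : U = \bigcup_z (if `[< box z `<=` U >] then box z else set0).
  apply/seteqP; split=> [x Ux|x [z _]]; last by case: asboolP => // /[apply].
  have [e /= e0 xeU] := (nbhs_ballP _ _).1 (open_nbhs_nbhs (conj oU Ux)).
  have [k] := ltr_add_invr e0; rewrite add0r => ke.
  (* The centre is within half of [1 / (k + 1)] of [x] in each coordinate, and the box has that half
     as radius, so the box stays within [1 / (k + 1) < e] of [x]. *)
  have /choice[q qP] i : exists q : rat,
      `|ratr q - x ord0 i| < k.+1%:R^-1 / 2 :> R.
    have : 0 < k.+1%:R^-1 / 2 :> R by rewrite divr_gt0.
    move: (_ / 2) => h h0.
    have [q] := @rat_in_itvoo R (x ord0 i - h) (x ord0 i + h) ltac:(lra).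
    by rewrite in_itv/= => /andP[? ?]; exists q; rewrite ltr_norml; lra.
  have [m km] : exists m : nat, m.+1%:R^-1 = k.+1%:R^-1 / 2 :> R.
    by exists (k.+1 * 2).-1; rewrite prednK ?muln_gt0// natrM invfM.
  exists (\row_i q i, m) => //.
  rewrite asboolT; first by apply/boxE => i; rewrite mxE km.
  move=> y /boxE/= yq; apply: xeU; split=> // i j.
  rewrite ord1 /ball/= distrC -(subrK (ratr (q j)) (y ord0 j)) -addrA.
  rewrite (le_lt_trans (ler_normD _ _))// (le_lt_trans _ ke)//.
  rewrite (splitr k.+1%:R^-1) -km distrC ltW// ltrD//.
    by have := yq j; rewrite mxE.
  by rewrite km; exact: qP.
apply: countable_bigcupT_measurable; first exact: countableP.
move=> z; case: ifPn => // _; apply: bigsetI_measurable => i _.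
rewrite -[X in measurable X]setTI; apply: (@measurable_coord R n i) => //.
exact: measurable_ball.
Qed.

Lemma continuous_measurable_rV (R : realType) (n : nat) (f : 'rV[R]_n -> R) :
  continuous f -> measurable_fun [set: 'rV[R]_n] (f : _ -> measurableTypeR R).
Proof.
move=> /continuousP cf.
apply: (measurability _ (RGenOpens.measurableE R)) => //.
move=> _ [_ [a [b ->]] <-]; rewrite setTI; apply: open_measurable_rV.
by apply: cf; exact: interval_open.
Qed.

Section integral_rV_succ.
Variables (R : realType) (n : nat).
Local Open Scope ereal_scope.
Local Notation prodm := (@lebesgue_measure R \x lebesgue_rV R n).

Lemma ge0_integral_rVS (f : 'rV[R]_n.+1 -> \bar R) :
  measurable_fun [set: 'rV[R]_n.+1] f -> (forall x, 0 <= f x) ->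
  \int[lebesgue_rV R n.+1]_x f x = \int[prodm]_z f (rV_cons z).
Proof.
move=> mf f0; have := @ge0_integral_pushforward _ _ _ _ R _
  (@measurable_rV_cons R n) prodm setT f measurableT mf (fun y _ => f0 y).
by rewrite preimage_setT.
Qed.

Lemma integrable_rVS (f : 'rV[R]_n.+1 -> \bar R) :
  (lebesgue_rV R n.+1).-integrable setT f ->
  prodm.-integrable setT (fun z => f (rV_cons z)).
Proof.
move=> /integrableP[mf foo]; apply/integrableP; split.
  exact: measurableT_comp mf (@measurable_rV_cons R n).
by rewrite -(ge0_integral_rVS (f := fun x => `|f x|))//; exact: measurableT_comp.
Qed.

Lemma integral_rVS (f : 'rV[R]_n.+1 -> \bar R) :
  (lebesgue_rV R n.+1).-integrable setT f ->
  \int[lebesgue_rV R n.+1]_x f x = \int[prodm]_z f (rV_cons z).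
Proof.
move=> fi; have := @integral_pushforward _ _ _ _ R _
  (@measurable_rV_cons R n) prodm setT f (measurable_int _ fi).
by rewrite preimage_setT => -> //; exact: integrable_rVS.
Qed.

End integral_rV_succ.

(** * Integrals of derivatives of functions that vanish at infinity *)

Lemma vanishes_at_infinity_cvg (R : realType) (f : R -> R) :
  (forall e, 0 < e -> exists M, forall t, M < `|t| -> `|f t| < e) ->
  f x @[x --> +oo%R] --> (0 : R) /\ f x @[x --> -oo%R] --> (0 : R).
Proof.
move=> f0; split; apply/cvgr0Pnorm_lt => e e0; have [M fM] := f0 e e0.
- near=> x; apply: fM; apply: lt_le_trans (ler_norm x).
  by near: x; apply: nbhs_pinfty_gt; rewrite num_real.
- near=> x; apply: fM; rewrite -normrN; apply: lt_le_trans (ler_norm (- x)).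
  by rewrite ltrNr; near: x; apply: nbhs_ninfty_lt; rewrite num_real.
Unshelve. all: by end_near. Qed.

(** The integrals over growing symmetric intervals have two limits: the full integral, by dominated
    convergence, and zero, by the fundamental theorem of calculus and the decay of [f]. *)
Lemma integral_derivative_vanishing (R : realType) (f g : R -> R) :
  (forall t : R, is_derive t 1 f (g t)) -> continuous g ->
  (forall e, 0 < e -> exists M, forall t, M < `|t| -> `|f t| < e) ->
  lebesgue_measure.-integrable setT (EFin \o g) ->
  (\int[lebesgue_measure]_t (g t)%:E = 0)%E.
Proof.
move=> fg cg /vanishes_at_infinity_cvg[fy fNy] ig.
have mg : measurable_fun setT (EFin \o g) by exact: measurable_int ig.
have cvgrS : (n.+1%:R : R) @[n --> \oo] --> +oo%R.
  by rewrite (cvg_shiftS (fun n => n%:R : R)); exact: cvgr_idn.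
(* With [n.+1] in place of [n] no interval is degenerate, as [continuous_FTC2] requires distinct
   endpoints. *)
pose D n : set R := `[- n.+1%:R, n.+1%:R]%classic.
have f_cont : continuous f.
  by move=> x; apply: differentiable_continuous; apply/derivable1_diffP.
have cvg1 : (\int[lebesgue_measure]_(t in D n) (g t)%:E @[n --> \oo] -->
    \int[lebesgue_measure]_t (g t)%:E)%E.
  under eq_cvg do rewrite integral_mkcond.
  have [|||||] := @dominated_convergence _ _ R (@lebesgue_measure R) setT
    measurableT (fun n => (EFin \o g) \_ (D n)) (EFin \o g) (abse \o (EFin \o g)).
  - move=> n; have mD : measurable (D n) by exact: measurable_itv.
    apply: ((measurable_restrictT _ mD).1 _).
    exact: measurable_funS mg.
  - by [].
  - apply: aeW => x _; apply: cvg_near_cst; near=> n.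
    rewrite patchE mem_set// /D/= in_itv/= -ler_norml.
    near: n; exact: (cvgryPge _).1 cvgrS `|x|.
  - exact: integrable_abse.
  - apply: aeW => x n _; rewrite patchE; case: ifPn => // _.
    by rewrite abse0 abse_ge0.
  - by [].
have cvg2 : (\int[lebesgue_measure]_(t in D n) (g t)%:E @[n --> \oo] --> 0)%E.
  have -> : (fun n => \int[lebesgue_measure]_(t in D n) (g t)%:E)%E =
            EFin \o (fun n => f n.+1%:R - f (- n.+1%:R)).
    apply/funext => n /=; rewrite EFinB; apply: continuous_FTC2.
    - by rewrite gtrN.
    - exact: continuous_subspaceT.
    - split; first by move=> x _; exact: ex_derive.
      + exact/cvg_at_right_filter/f_cont.
      + exact/cvg_at_left_filter/f_cont.
    - by move=> x _; rewrite derive1E derive_val.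
  apply: cvg_EFin; first exact: nearW.
  rewrite /= -[X in _ --> X](subr0 0); apply: cvgB.
  - exact: cvg_comp cvgrS fy.
  - by apply: cvg_comp fNy; apply/cvgNrNy.
by have := cvg_unique _ cvg1 cvg2; apply.
Unshelve. all: by end_near. Qed.

Section partial_derivatives.
Variable R : realType.

Lemma continuous_rV (X : topologicalType) (n : nat) (f : X -> 'rV[R]_n) :
  (forall i, continuous (fun t => f t ord0 i)) -> continuous f.
Proof.
move=> fc x A [P Px PA].
have : \forall y \near x, forall i, P ord0 i (f y ord0 i).
  by apply: filter_forall => i; apply: (fc i x); exact: Px.
by apply: filterS => y yP; apply: PA => i j; rewrite ord1.
Qed.

Lemma rV_consD n (s t : R) (u v : 'rV[R]_n) :
  rV_cons (s + t, u + v) = rV_cons (s, u) + rV_cons (t, v).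
Proof.
apply/rowP => i; rewrite [RHS]mxE; case: (unliftP ord0 i) => [j ->|->].
  by rewrite !rV_consS [LHS]mxE.
by rewrite !rV_cons0.
Qed.

Lemma rV_consZ n (h t : R) (v : 'rV[R]_n) :
  rV_cons (h * t, h *: v) = h *: rV_cons (t, v).
Proof.
apply/rowP => i; rewrite [RHS]mxE; case: (unliftP ord0 i) => [j ->|->].
  by rewrite !rV_consS [LHS]mxE.
by rewrite !rV_cons0.
Qed.

Lemma delta_rV_cons0 n :
  delta_mx ord0 ord0 = rV_cons (1, 0) :> 'rV[R]_n.+1.
Proof.
apply/rowP => i; rewrite [LHS]mxE; case: (unliftP ord0 i) => [j ->|->].
  by rewrite rV_consS [RHS]mxE.
by rewrite rV_cons0.
Qed.

Lemma delta_rV_consS n (i : 'I_n) :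
  delta_mx ord0 (lift ord0 i) = rV_cons (0, delta_mx ord0 i) :> 'rV[R]_n.+1.
Proof.
apply/rowP => j; rewrite [LHS]mxE; case: (unliftP ord0 j) => [k ->|->].
  by rewrite rV_consS [RHS]mxE/= (inj_eq lift_inj).
by rewrite rV_cons0.
Qed.

Lemma continuous_rV_consl n (v : 'rV[R]_n) :
  continuous (fun t : R => rV_cons (t, v)).
Proof.
apply: continuous_rV => i; case: (unliftP ord0 i) => [j ->|->].
  under eq_fun do rewrite rV_consS.
  exact: cst_continuous.
under eq_fun do rewrite rV_cons0.
by move=> t; apply: cvg_id.
Qed.

Lemma continuous_rV_consr n (t : R) :
  continuous (fun v : 'rV[R]_n => rV_cons (t, v)).
Proof.
apply: continuous_rV => i; case: (unliftP ord0 i) => [j ->|->].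
  under eq_fun do rewrite rV_consS.
  exact: coord_continuous.
under eq_fun do rewrite rV_cons0.
exact: cst_continuous.
Qed.

(** The difference quotients on the two sides are the same function of [h], so no differentiability
    beyond this direction is involved. *)
Lemma is_derive_rV_cons0 n (f : 'rV[R]_n.+1 -> R) t v l :
  is_derive (rV_cons (t, v)) (delta_mx ord0 ord0) f l ->
  is_derive t 1 (fun s => f (rV_cons (s, v))) l.
Proof.
move=> [df <-]; have E : (fun h : R => h^-1 *:
    ((f \o shift (rV_cons (t, v))) (h *: delta_mx ord0 ord0) -
      f (rV_cons (t, v)))) =
    (fun h => h^-1 *: (((fun s => f (rV_cons (s, v))) \o shift t) (h *: 1) -
      f (rV_cons (t, v)))).
  apply/funext => h /=; rewrite delta_rV_cons0 -rV_consZ -rV_consD.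
  by rewrite scaler0 add0r.
by split; [rewrite /derivable -E|rewrite /derive -E].
Qed.

Lemma is_derive_rV_consS n (f : 'rV[R]_n.+1 -> R) t v i l :
  is_derive (rV_cons (t, v)) (delta_mx ord0 (lift ord0 i)) f l ->
  is_derive v (delta_mx ord0 i) (fun u => f (rV_cons (t, u))) l.
Proof.
move=> [df <-]; have E : (fun h : R => h^-1 *:
    ((f \o shift (rV_cons (t, v))) (h *: delta_mx ord0 (lift ord0 i)) -
      f (rV_cons (t, v)))) =
    (fun h => h^-1 *: (((fun u => f (rV_cons (t, u))) \o shift v)
      (h *: delta_mx ord0 i) - f (rV_cons (t, v)))).
  apply/funext => h /=; rewrite delta_rV_consS -rV_consZ -rV_consD.
  by rewrite mulr0 add0r.
by split; [rewrite /derivable -E|rewrite /derive -E].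
Qed.

Lemma dotp_rV_cons n s t (u v : 'rV[R]_n) :
  dotp (rV_cons (s, u)) (rV_cons (t, v)) = s * t + dotp u v.
Proof.
rewrite /dotp big_ord_recl !rV_cons0; congr (_ + _).
by apply: eq_bigr => i _; rewrite !rV_consS.
Qed.

Lemma dotp_ge0 n (x : 'rV[R]_n) : 0 <= dotp x x.
Proof. by apply: sumr_ge0 => i _; rewrite -expr2 sqr_ge0. Qed.

Lemma enorm_sqr n (x : 'rV[R]_n) : enorm x ^+ 2 = dotp x x.
Proof. by rewrite sqr_sqrtr// dotp_ge0. Qed.

(** Adding coordinates can only increase the Euclidean norm, so the radius found for [f] also serves
    for its slices. *)
Lemma vanishes_at_infinity_rV_consl n (f : 'rV[R]_n.+1 -> R) v :
  vanishes_at_infinity f -> forall e, 0 < e ->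
  exists M, forall t, M < `|t| -> `|f (rV_cons (t, v))| < e.
Proof.
move=> f0 e /f0[M fM]; exists M => t Mt; apply: fM; apply: lt_le_trans Mt _.
by rewrite -sqrtr_sqr ler_wsqrtr// dotp_rV_cons expr2 lerDl dotp_ge0.
Qed.

Lemma vanishes_at_infinity_rV_consr n (f : 'rV[R]_n.+1 -> R) t :
  vanishes_at_infinity f -> vanishes_at_infinity (fun v => f (rV_cons (t, v))).
Proof.
move=> f0 e /f0[M fM]; exists M => v Mv; apply: fM; apply: lt_le_trans Mv _.
by rewrite ler_wsqrtr// dotp_rV_cons lerDr -expr2 sqr_ge0.
Qed.

(** Induction on the dimension, splitting off the first coordinate. Fubini yields integrability of
    [g] on almost every slice only, which is enough to replace the inner integral by zero. *)
Lemma integral_partial_derivative n (f g : 'rV[R]_n -> R) i :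
  (forall x, is_derive x (delta_mx ord0 i) f (g x)) -> continuous g ->
  vanishes_at_infinity f -> (lebesgue_rV R n).-integrable setT (EFin \o g) ->
  (\int[lebesgue_rV R n]_x (g x)%:E = 0)%E.
Proof.
elim: n => [|n IHn] in f g i *; first by case: i.
move=> fg cg f0 ig; rewrite (integral_rVS ig).
have igc := integrable_rVS ig.
case: (unliftP ord0 i) fg => [j ->|->] fg.
  (* The differentiated coordinate lies in the tail: the tail is integrated first, by the induction
     hypothesis. *)
  rewrite -(integral12_prod_meas1 igc).
  rewrite -[RHS](@integral0 _ _ _ (@lebesgue_measure R) setT).
  apply: ae_eq_integral => //; first exact: measurable_fubini_F igc.
  have := ae_integrable1 igc; apply: filterS => t igt _.
  rewrite /fubini_F; apply: (IHn (fun v => f (rV_cons (t, v))) _ j) => //.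
  - by move=> v; exact: is_derive_rV_consS.
  - move=> v; apply: (@continuous_comp _ _ _ (fun v => rV_cons (t, v)) g); last exact: cg.
    exact: continuous_rV_consr.
  - exact: vanishes_at_infinity_rV_consr.
(* The differentiated coordinate is the first one: it is integrated first, by the one-dimensional
   case. *)
rewrite -(integral21_prod_meas1 igc).
rewrite -[RHS](@integral0 _ _ _ (lebesgue_rV R n) setT).
apply: ae_eq_integral => //; first exact: measurable_fubini_G igc.
have := ae_integrable2 igc; apply: filterS => v igv _.
rewrite /fubini_G.
apply: (@integral_derivative_vanishing R (fun t => f (rV_cons (t, v)))) => //.
- by move=> t; exact: is_derive_rV_cons0.
- move=> t; apply: (@continuous_comp _ _ _ (fun t => rV_cons (t, v)) g); last exact: cg.
  exact: continuous_rV_consl.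
- exact: vanishes_at_infinity_rV_consl.
Qed.

End partial_derivatives.

(** * Gaussian densities *)

Section gaussian.
Variables (R : realType) (n : nat).
Implicit Types (s : R) (m x : 'rV[R]_n).

(** The normal law with independent coordinates of variance [s]. The transition density is the case
    [s = 2 mu T dt] with mean [x + mu dt F(x)], see [transition_gaussian]. *)
Definition gaussian s m x : R :=
  ((2 * pi * s) `^ (n%:R / 2))^-1 * expR (- (enorm (x - m) ^+ 2 / (2 * s))).

Lemma gaussian_gt0 s m x : 0 < s -> 0 < gaussian s m x.
Proof.
move=> s0; rewrite mulr_gt0 ?expR_gt0// invr_gt0 powR_gt0//.
by rewrite !mulr_gt0 ?pi_gt0.
Qed.

Lemma gaussian_normal_pdf s m x : 0 < s ->
  gaussian s m x = \prod_i normal_pdf (m ord0 i) (Num.sqrt s) (x ord0 i).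
Proof.
move=> s0.
(* [normal_pdf] takes the standard deviation as parameter and treats the value zero as a separate
   case. *)
have ss0 : Num.sqrt s != 0 by rewrite gt_eqF// sqrtr_gt0.
under eq_bigr do rewrite /normal_pdf (negbTE ss0) /normal_fun.
rewrite big_split/= prodr_const card_ord -expR_sum /normal_peak.
rewrite sqr_sqrtr ?ltW// /gaussian; congr (_ * expR _).
  rewrite exprVn; congr (_^-1); rewrite -powR12_sqrt; last first.
    by rewrite mulrn_wge0// mulr_ge0 ?pi_ge0// ltW.
  rewrite -powR_mulrn ?powR_ge0// -powRrM; congr (_ `^ _); last by rewrite mulrC.
  by rewrite -mulr_natl; ring.
rewrite enorm_sqr /dotp mulr_suml -sumrN; apply: eq_bigr => i _.
by rewrite !mxE -expr2 mulNr -[s *+ 2]mulr_natl.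
Qed.

End gaussian.

Lemma integral_prod_normal_pdf (R : realType) (n : nat) (s : R) (m : 'rV[R]_n) :
  (\int[lebesgue_rV R n]_x
    (\prod_i normal_pdf (m ord0 i) s (x ord0 i))%:E = 1)%E.
Proof.
elim: n m => [|n IHn] m.
  under eq_integral do rewrite big_ord0.
  by rewrite integral_dirac// diracE in_setT mul1e.
have mprod k (u : 'rV[R]_k) :
    measurable_fun setT (fun x : 'rV[R]_k =>
      (\prod_i normal_pdf (u ord0 i) s (x ord0 i))%:E).
  apply/measurable_EFinP; apply: measurable_prod => i _.
  apply: (measurableT_comp (measurable_normal_pdf _ _)).
  exact: measurable_coord.
have prod_ge0 k (u x : 'rV[R]_k) :
    (0 <= (\prod_i normal_pdf (u ord0 i) s (x ord0 i))%:E)%E.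
  by rewrite lee_fin prodr_ge0// => i _; exact: normal_pdf_ge0.
rewrite ge0_integral_rVS//.
rewrite fubini_tonelli1//; last first.
  exact: (measurableT_comp (mprod _ m) (@measurable_rV_cons R n)).
rewrite -(@integral_normal_pdf R (m ord0 ord0) s).
apply: eq_integral => t _; rewrite /fubini_F.
pose m' : 'rV[R]_n := \row_i m ord0 (lift ord0 i).
transitivity (\int[lebesgue_rV R n]_v ((normal_pdf (m ord0 ord0) s t)%:E *
    (\prod_i normal_pdf (m' ord0 i) s (v ord0 i))%:E))%E.
  apply: eq_integral => v _; rewrite big_ord_recl rV_cons0 -EFinM.
  by congr (_ * _)%:E; apply: eq_bigr => i _; rewrite rV_consS mxE.
rewrite ge0_integralZl//; last 2 first.
- exact: mprod.
- by rewrite lee_fin normal_pdf_ge0.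
by rewrite IHn mule1.
Qed.

Lemma integral_gaussian (R : realType) (n : nat) (s : R) (m : 'rV[R]_n) :
  0 < s -> (\int[lebesgue_rV R n]_x (gaussian s m x)%:E = 1)%E.
Proof.
move=> s0; under eq_integral do rewrite gaussian_normal_pdf//.
exact: integral_prod_normal_pdf.
Qed.

(** * Decay of Gaussian densities against quadratic factors *)

Section gaussian_decay.
Variables (R : realType) (n : nat).
Implicit Types (s : R) (m x : 'rV[R]_n).

(* From [y <= 4 s exp (y / 4 s)]: a quadratic factor is absorbed by doubling
   the variance. *)
Lemma gaussian_sqr_le s : 0 < s -> exists2 K : R, 0 <= K &
  forall m x, (1 + enorm (x - m) ^+ 2) * gaussian s m x <=
              K * gaussian (2 * s) m x.
Proof.
move=> s0; rewrite /gaussian.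
set c := ((2 * pi * s) `^ _)^-1; set c' := ((2 * pi * (2 * s)) `^ _)^-1.
have c0 : 0 < c.
  by rewrite invr_gt0 powR_gt0// !mulr_gt0 ?pi_gt0.
have c'0 : 0 < c'.
  by rewrite invr_gt0 powR_gt0// !mulr_gt0 ?pi_gt0.
(* The ratio [c / c'] exchanges the two normalisations, and [1 + 4 s] comes from bounding [1] and
   [y] separately by multiples of [exp (y / 4 s)]. *)
exists ((1 + 4 * s) * c / c') => [|m x].
  by rewrite divr_ge0 ?mulr_ge0 ?addr_ge0 ?mulr_ge0// ltW.
have := sqr_ge0 (enorm (x - m)); move: (_ ^+ 2) => y y0.
have -> : - (y / (2 * s)) = - (y / (2 * (2 * s))) + - (y / (2 * (2 * s))).
  by field; rewrite gt_eqF.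
rewrite expRD; set E := expR _.
have E0 : 0 < E by exact: expR_gt0.
rewrite [leRHS](_ : _ = c * E * (1 + 4 * s)); last by field; rewrite gt_eqF.
rewrite [leLHS](_ : _ = c * E * ((1 + y) * E)); last by ring.
rewrite ler_pM2l ?mulr_gt0// -ler_pdivlMr// -expRN opprK.
have := expR_ge1Dx (y / (2 * (2 * s))); set z := (y / _) => zE.
have z0 : 0 <= z by rewrite divr_ge0// !mulr_ge0// ltW.
have -> : y = 4 * s * z by rewrite /z; field; rewrite gt_eqF.
have : 0 <= 4 * s * (expR z - z) by rewrite mulr_ge0 ?mulr_ge0 ?ltW//; lra.
by nra.
Qed.

Lemma dotpD_le (u v : 'rV[R]_n) :
  dotp (u + v) (u + v) <= 2 * dotp u u + 2 * dotp v v.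
Proof.
rewrite /dotp !mulr_sumr -big_split/=; apply: ler_sum => i _; rewrite mxE.
by have := sqr_ge0 (u ord0 i - v ord0 i); nra.
Qed.

(** Doubling the variance twice bounds the density times the square of [1 + |x - m|^2]; one factor
    is then left over to force the decay. *)
Lemma gaussian_sqr_vanishing s m : 0 < s ->
  vanishes_at_infinity (fun x => (1 + enorm (x - m) ^+ 2) * gaussian s m x).
Proof.
move=> s0.
have [K K0 KP] := gaussian_sqr_le s0.
have [K' K'0 K'P] := gaussian_sqr_le (mulr_gt0 (ltr0Sn R 1) s0).
set c := ((2 * pi * (2 * (2 * s))) `^ (n%:R / 2))^-1.
have c0 : 0 <= c by rewrite invr_ge0 powR_ge0.
pose C := K * (K' * c).
have C0 : 0 <= C by rewrite !mulr_ge0.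
have CP x : (1 + enorm (x - m) ^+ 2) * gaussian s m x * (1 + enorm (x - m) ^+ 2) <= C.
  have y0 : 0 <= 1 + enorm (x - m) ^+ 2 by rewrite addr_ge0 ?sqr_ge0.
  apply: le_trans (ler_wpM2r y0 (KP m x)) _.
  rewrite -mulrA ler_wpM2l// mulrC; apply: le_trans (K'P m x) _.
  rewrite ler_wpM2l// /gaussian ler_piMr//.
  by rewrite -[leRHS]expR0 ler_expR oppr_le0 divr_ge0 ?sqr_ge0// !mulr_ge0// ltW.
(* Beyond this radius [|x| >= 1], so [|x| <= |x|^2 <= 2 |x - m|^2 + 2 |m|^2], which gives
   [1 + |x - m|^2 > C / e]. *)
move=> e e0; exists (1 + 2 * (C / e) + 2 * dotp m m) => x.
have Ce0 : 0 <= C / e by rewrite divr_ge0// ltW.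
have := dotp_ge0 m; have := dotpD_le (x - m) m; rewrite subrK.
move: (CP x); have := gaussian_gt0 m x s0.
rewrite (enorm_sqr (x - m)); have := enorm_sqr x; have := dotp_ge0 (x - m).
move: (dotp (x - m) _) (dotp m m) (gaussian _ _ _) => y a g y0 xx g0 CPx xya a0 Mx.
have y1 : 0 < 1 + y by lra.
rewrite ger0_norm ?mulr_ge0 ?ltW//.
rewrite -(ltr_pM2r y1); apply: le_lt_trans CPx _.
rewrite -ltr_pdivrMl//.
rewrite mulrC.
have := sqrtr_ge0 (dotp x x); rewrite -/(enorm x) => ex0.
have : enorm x <= enorm x ^+ 2 by rewrite expr2; nra.
lra.
Qed.

End gaussian_decay.

(** * Derivatives and second moments of Gaussian densities *)

Section gaussian_moments.
Variables (R : realType) (n : nat).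
Implicit Types (s : R) (m x u v : 'rV[R]_n).

(** This moves a directional derivative to a derivative in one real variable, where the [is_derive]
    instances can compute it. *)
Lemma is_derive_lineP (f : 'rV[R]_n -> R) x v l :
  is_derive (0 : R) 1 (fun h => f (h *: v + x)) l <-> is_derive x v f l.
Proof.
have E : (fun h : R => h^-1 *: ((f \o shift x) (h *: v) - f x)) =
    (fun h => h^-1 *: (((fun h => f (h *: v + x)) \o shift 0) (h *: 1) -
      f (0 *: v + x))).
  apply/funext => h /=; rewrite addr0 scale0r add0r.
  by rewrite [h *: 1 in RHS]mulr1.
split=> -[df <-]; split.
- by rewrite /derivable E.
- by rewrite /derive E.
- by rewrite /derivable -E.
- by rewrite /derive -E.
Qed.

Lemma dotp_delta u i : dotp u (delta_mx ord0 i) = u ord0 i.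
Proof.
rewrite /dotp (bigD1 i)//= big1 ?addr0 => [|j ji].
  by rewrite mxE !eqxx mulr1.
by rewrite mxE (negbTE ji) andbF mulr0.
Qed.

Lemma dotpC u v : dotp u v = dotp v u.
Proof. by apply: eq_bigr => i _; rewrite mulrC. Qed.

Lemma dotpDr u v x : dotp u (v + x) = dotp u v + dotp u x.
Proof.
by rewrite -big_split/=; apply: eq_bigr => i _; rewrite mxE mulrDr.
Qed.

Lemma dotpZr u (a : R) v : dotp u (a *: v) = a * dotp u v.
Proof. by rewrite mulr_sumr; apply: eq_bigr => i _; rewrite mxE mulrCA. Qed.

Lemma dotpDl u v x : dotp (u + v) x = dotp u x + dotp v x.
Proof. by rewrite !(dotpC _ x) dotpDr. Qed.

Lemma dotpZl (a : R) u v : dotp (a *: u) v = a * dotp u v.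
Proof. by rewrite !(dotpC _ v) dotpZr. Qed.

Lemma dotp_line (h : R) i x :
  dotp (h *: delta_mx ord0 i + x) (h *: delta_mx ord0 i + x) =
  h ^+ 2 + 2 * x ord0 i * h + dotp x x.
Proof.
rewrite dotpDr !dotpDl !dotpZr !dotpZl (dotpC (delta_mx _ _) x) !dotp_delta.
by rewrite mxE !eqxx /=; ring.
Qed.

Lemma continuous_coordB m i : continuous (fun x => (x - m) ord0 i).
Proof.
under eq_fun do rewrite !mxE.
by move=> x; apply: continuousB; [exact: coord_continuous|exact: cst_continuous].
Qed.

Lemma continuous_dotp u m : continuous (fun x => dotp u (x - m)).
Proof.
rewrite /dotp; apply: continuous_big => [|i _ x]; first exact: add_continuous.
by apply: continuousM; [exact: cst_continuous|exact: continuous_coordB].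
Qed.

Lemma continuous_enorm_sqr m : continuous (fun x => enorm (x - m) ^+ 2).
Proof.
under eq_fun do rewrite enorm_sqr.
rewrite /dotp; apply: continuous_big => [|i _ x]; first exact: add_continuous.
by apply: continuousM; exact: continuous_coordB.
Qed.

Lemma continuous_gaussian s m : continuous (gaussian s m).
Proof.
move=> x; pose c : 'rV[R]_n -> R := cst ((2 * pi * s) `^ (n%:R / 2))^-1.
apply: (@continuousM _ _ c (fun x => expR (- (enorm (x - m) ^+ 2 / (2 * s))))).
  exact: cst_continuous.
apply: (@continuous_comp _ _ _ (fun x => - (enorm (x - m) ^+ 2 / (2 * s))) expR);
  last exact: continuous_expR.
apply: continuousN; apply: continuousM; last exact: cst_continuous.
exact: continuous_enorm_sqr.
Qed.

Lemma is_derive_gaussian s m x i : 0 < s ->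
  is_derive x (delta_mx ord0 i) (gaussian s m)
    (- (s^-1 * (x - m) ord0 i * gaussian s m x)).
Proof.
move=> s0; apply/is_derive_lineP.
set y := x - m; set c := ((2 * pi * s) `^ (n%:R / 2))^-1.
(* On a line the exponent is a quadratic polynomial in [h]; it is written with function combinators
   so that the derivative is found by instance resolution. *)
have -> : (fun h : R => gaussian s m (h *: delta_mx ord0 i + x)) =
    c \*: (expR \o (- (2 * s)^-1 \*: (id ^+ 2 + (2 * y ord0 i) \*: id +
      cst (dotp y y)))).
  apply/funext => h; rewrite /gaussian -/c enorm_sqr -addrA -/y /=.
  rewrite dotp_line !fctE /= /GRing.scale/= -mulrN.
  by congr (_ * expR _); field; rewrite gt_eqF.
apply: is_derive_eq.
rewrite /gaussian -/c -/y enorm_sqr !fctE /= /GRing.scale/=.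
have -> : - (2 * s)^-1 * (0 ^+ 2 + 2 * y ord0 i * 0 + dotp y y) =
    - (dotp y y / (2 * s)).
  by field; rewrite gt_eqF.
by field; rewrite gt_eqF.
Qed.

Lemma is_derive_dotp u m x i :
  is_derive x (delta_mx ord0 i) (fun x => dotp u (x - m)) (u ord0 i).
Proof.
apply/is_derive_lineP.
have -> : (fun h : R => dotp u (h *: delta_mx ord0 i + x - m)) =
   u ord0 i \*: id + cst (dotp u (x - m)).
  apply/funext => h; rewrite -addrA [LHS]dotpDr dotpZr dotp_delta !fctE.
  by rewrite mulrC.
apply: is_derive_eq.
by rewrite addr0 [_ *: 1]mulr1.
Qed.

Lemma normr_coord_le x i : `|x ord0 i| <= enorm x.
Proof.
rewrite -sqrtr_sqr ler_wsqrtr// /dotp (bigD1 i)//= expr2 lerDl.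
by apply: sumr_ge0 => j _; rewrite -expr2 sqr_ge0.
Qed.

Lemma normr_dotp_le u x : `|dotp u x| <= (\sum_i `|u ord0 i|) * enorm x.
Proof.
apply: le_trans (ler_norm_sum _ _ _) _; rewrite mulr_suml.
by apply: ler_sum => i _; rewrite normrM ler_wpM2l// normr_coord_le.
Qed.

Lemma integrable_gaussian s m : 0 < s ->
  (lebesgue_rV R n).-integrable setT (EFin \o gaussian s m).
Proof.
move=> s0; apply/integrableP; split.
  by apply/measurable_EFinP; apply: continuous_measurable_rV; exact: continuous_gaussian.
under eq_integral do rewrite /= ger0_norm ?(ltW (gaussian_gt0 _ _ s0))//.
by rewrite integral_gaussian// ltry.
Qed.

(** By [gaussian_sqr_le] the product is dominated by a multiple of the Gaussian of doubled
    variance. *)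
Lemma integrable_gaussianM s m (f : 'rV[R]_n -> R) (C : R) : 0 < s ->
  measurable_fun setT f ->
  (forall x, `|f x| <= C * (1 + enorm (x - m) ^+ 2)) ->
  (lebesgue_rV R n).-integrable setT (EFin \o (fun x => f x * gaussian s m x)).
Proof.
move=> s0 mf fC; have [K K0 KP] := gaussian_sqr_le n s0.
have s20 : 0 < 2 * s by rewrite mulr_gt0.
(* The growth bound at [x = m] reads [|f m| <= C]. *)
have C0 : 0 <= C.
  have := le_trans (normr_ge0 _) (fC m); rewrite subrr enorm_sqr.
  by rewrite /dotp big1 ?addr0 ?mulr1// => i _; rewrite mxE mul0r.
apply: (le_integrable measurableT _ _
  (integrableZl measurableT (C * K) (integrable_gaussian m s20))).
- apply/measurable_EFinP/measurable_funM => //.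
  by apply: continuous_measurable_rV; exact: continuous_gaussian.
- move=> x _ /=; rewrite lee_fin [leRHS]ger0_norm; last first.
    by rewrite mulr_ge0 ?(mulr_ge0 C0 K0) ?(ltW (gaussian_gt0 _ _ s20)).
  rewrite normrM (ger0_norm (ltW (gaussian_gt0 _ _ s0))).
  apply: le_trans (ler_wpM2r (ltW (gaussian_gt0 _ _ s0)) (fC x)) _.
  by rewrite -!mulrA ler_wpM2l.
Qed.

Lemma vanishes_at_infinity_gaussianM s m (f : 'rV[R]_n -> R) (C : R) : 0 < s ->
  (forall x, `|f x| <= C * (1 + enorm (x - m) ^+ 2)) ->
  vanishes_at_infinity (fun x => f x * gaussian s m x).
Proof.
(* The sign of [C] is not known here; [|C| + 1] is a positive upper bound by which one can
   divide. *)
move=> s0 fC e e0; have C1 : 0 < `|C| + 1 by rewrite ltr_wpDl.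
have [M fM] := gaussian_sqr_vanishing m s0 (divr_gt0 e0 C1).
exists M => x /fM; rewrite ger0_norm; last first.
  by rewrite mulr_ge0 ?(ltW (gaussian_gt0 _ _ s0))// addr_ge0// sqr_ge0.
rewrite ltr_pdivlMr// => /(le_lt_trans _); apply.
rewrite normrM (ger0_norm (ltW (gaussian_gt0 _ _ s0))) mulrAC.
rewrite ler_wpM2r ?(ltW (gaussian_gt0 _ _ s0))//; apply: le_trans (fC x) _.
rewrite mulrC ler_wpM2l ?addr_ge0 ?sqr_ge0//.
by rewrite (le_trans (ler_norm _))// lerDl.
Qed.

Lemma normr_dotpM_le u x i : `|dotp u x * x ord0 i| <=
  (\sum_i `|u ord0 i|) * (1 + enorm x ^+ 2).
Proof.
rewrite normrM; apply: le_trans (ler_pM _ _ (normr_dotp_le _ _)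
  (normr_coord_le _ _)) _ => //.
by rewrite -mulrA ler_wpM2l ?sumr_ge0// -expr2 lerDr.
Qed.

Lemma integrable_gaussian_dotpM s m u i : 0 < s ->
  (lebesgue_rV R n).-integrable setT (EFin \o (fun x =>
    dotp u (x - m) * (x - m) ord0 i * gaussian s m x)).
Proof.
move=> s0; apply: integrable_gaussianM s0 _ (fun x => normr_dotpM_le u (x - m) i).
apply: measurable_funM.
  by apply: continuous_measurable_rV; exact: continuous_dotp.
by apply: continuous_measurable_rV; exact: continuous_coordB.
Qed.

(** Stein's identity: the [i]-th partial derivative of [dotp u (x - m)] times the density is [u_i]
    times the density minus [s^-1] times the integrand, and it integrates to zero. *)
Lemma gaussian_moment s m u i : 0 < s ->
  \int[lebesgue_rV R n]_x (dotp u (x - m) * (x - m) ord0 i * gaussian s m x) =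
  s * u ord0 i.
Proof.
move=> s0.
have U0 : 0 <= \sum_i `|u ord0 i| by exact: sumr_ge0.
have e_le x : enorm x <= 1 + enorm x ^+ 2.
  by have := sqr_ge0 (enorm x - 1); have := sqr_ge0 (enorm x); lra.
have i1 := integrable_gaussian_dotpM m u i s0.
have i0 := integrable_gaussian m s0.
have iZ : (lebesgue_rV R n).-integrable setT (EFin \o (fun x =>
    s^-1 * (dotp u (x - m) * (x - m) ord0 i * gaussian s m x))).
  exact: integrableZl i1.
have iU : (lebesgue_rV R n).-integrable setT (EFin \o (fun x =>
    u ord0 i * gaussian s m x)).
  exact: integrableZl i0.
have : \int[lebesgue_rV R n]_x (u ord0 i * gaussian s m x -
   s^-1 * (dotp u (x - m) * (x - m) ord0 i * gaussian s m x)) = 0.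
  rewrite /Rintegral; apply: (congr1 fine (y := 0%E)).
  apply: (@integral_partial_derivative _ _
    ((fun x => dotp u (x - m)) * gaussian s m) _ i).
  - move=> x; have d1 := is_derive_dotp u m x i.
    have d2 := is_derive_gaussian m x i s0.
    apply: is_derive_eq; rewrite /GRing.scale/=; ring.
  - move=> x; apply: (@continuousB _ _ _ (fun x => u ord0 i * gaussian s m x)).
      apply: continuousM; first exact: cst_continuous.
      exact: continuous_gaussian.
    apply: continuousM; first exact: cst_continuous.
    apply: continuousM; last exact: continuous_gaussian.
    by apply: continuousM; [exact: continuous_dotp|exact: continuous_coordB].
  - apply: vanishes_at_infinity_gaussianM s0 _ => x.
    apply: le_trans (normr_dotp_le _ _) _; exact: ler_wpM2l.
  - exact: integrableB iU iZ.
rewrite RintegralB// (@RintegralZl _ _ _ _ _ _ (u ord0 i))//.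
rewrite (@RintegralZl _ _ _ _ _ _ s^-1)//.
have -> : \int[lebesgue_rV R n]_x gaussian s m x = 1.
  by rewrite /Rintegral integral_gaussian.
rewrite mulr1 => /eqP.
by rewrite subr_eq0 => /eqP ->; rewrite mulVKf// gt_eqF.
Qed.

End gaussian_moments.

Lemma Rintegral_sum (n : nat) d (T : measurableType d) (R : realType)
    (mu : {measure set T -> \bar R})
    (h : 'I_n -> T -> R) :
  (forall i, mu.-integrable setT (EFin \o h i)) ->
  \int[mu]_x (\sum_i h i x) = \sum_i \int[mu]_x h i x.
Proof.
move=> ih; have ihE i : (\int[mu]_x (h i x)%:E = (\int[mu]_x h i x)%:E)%E.
  by rewrite fineK// (integrable_fin_num measurableT (ih i)).
rewrite {1}/Rintegral; under eq_integral do rewrite -sumEFin.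
rewrite integral_sum// (eq_bigr _ (fun i _ => ihE i)) sumEFin.
by [].
Qed.

Lemma integrable_sumR (n : nat) d (T : measurableType d) (R : realType)
    (mu : {measure set T -> \bar R})
    (h : 'I_n -> T -> R) :
  (forall i, mu.-integrable setT (EFin \o h i)) ->
  mu.-integrable setT (EFin \o (fun x => \sum_i h i x)).
Proof.
move=> ih; have : mu.-integrable setT (fun x => \sum_i (h i x)%:E)%E.
  by apply: integrable_sum => // i _; exact: ih.
by apply: eq_integrable => // x _; rewrite /= sumEFin.
Qed.

(** Expanding one factor of the square in coordinates leaves the moments of [gaussian_moment]. The
    integral is extended-real so that it can serve as the inner integral in Tonelli's theorem. *)
Lemma gaussian_dotp_sqr (R : realType) (n : nat) (s : R) (m u : 'rV[R]_n) : 0 < s ->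
  (\int[lebesgue_rV R n]_x (dotp u (x - m) ^+ 2 * gaussian s m x)%:E =
   (s * dotp u u)%:E)%E.
Proof.
move=> s0.
have ii i := integrableZl measurableT (u ord0 i) (integrable_gaussian_dotpM m u i s0).
have E x : dotp u (x - m) ^+ 2 * gaussian s m x = \sum_i
   (u ord0 i * (dotp u (x - m) * (x - m) ord0 i * gaussian s m x)).
  rewrite expr2 {2}/dotp mulr_sumr mulr_suml; apply: eq_bigr => i _.
  by rewrite !mulrA [u ord0 i * _]mulrC.
under eq_integral do rewrite E.
rewrite -[LHS]fineK; last by apply: integrable_fin_num => //; exact: integrable_sumR.
rewrite -/(Rintegral _ _ _) Rintegral_sum//; congr (_%:E).
rewrite mulr_sumr; apply: eq_bigr => i _.
rewrite RintegralZl//; last exact: integrable_gaussian_dotpM.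
by rewrite gaussian_moment// mulrCA.
Qed.

(** * The path density *)

Section measurable_dotp.
Context d (T : measurableType d) (R : realType) (n : nat).
Implicit Types u v : T -> 'rV[R]_n.

Lemma measurable_rVB u v : measurable_fun setT u -> measurable_fun setT v ->
  measurable_fun setT (fun t => u t - v t).
Proof.
move=> /measurable_fun_rVP mu /measurable_fun_rVP mv.
apply/measurable_fun_rVP => i; under eq_fun do rewrite !mxE.
exact: measurable_funB (mu i) (mv i).
Qed.

Lemma measurable_dotp u v : measurable_fun setT u -> measurable_fun setT v ->
  measurable_fun setT (fun t => dotp (u t) (v t) : measurableTypeR R).
Proof.
move=> /measurable_fun_rVP mu /measurable_fun_rVP mv.
by apply: measurable_sum => i; exact: measurable_funM (mu i) (mv i).
Qed.

Lemma measurable_gaussian (s : R) u v :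
  measurable_fun setT u -> measurable_fun setT v ->
  measurable_fun setT (fun t => gaussian s (u t) (v t) : measurableTypeR R).
Proof.
move=> mu mv; apply: measurable_funM; first exact: measurable_cst.
apply: (measurableT_comp (@measurable_expR R)); apply: measurableT_comp => //.
apply: measurable_funM; last exact: measurable_cst.
under eq_fun do rewrite enorm_sqr.
by apply: measurable_dotp; exact: measurable_rVB.
Qed.

End measurable_dotp.

Section gaussian_path.
Variables (R : realType) (d : nat) (s : R).
Variables (m nu : 'rV[R]_d -> 'rV[R]_d) (p : 'rV[R]_d -> R).
Hypotheses (s0 : 0 < s) (mm : measurable_fun setT m) (mnu : measurable_fun setT nu).
Hypotheses (p0 : forall x, 0 < p x).
Hypotheses (ip : (lebesgue_rV R d).-integrable setT (EFin \o p)).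
Hypotheses (inu : (lebesgue_rV R d).-integrable setT
  (EFin \o (fun x => dotp (nu x) (nu x) * p x))).

Let mp : measurable_fun setT p.
Proof. by apply/measurable_EFinP; exact: measurable_int ip. Qed.

Definition path_density (z : 'rV[R]_d * 'rV[R]_d) : R :=
  gaussian s (m z.2) z.1 * p z.2.

Definition path_score (z : 'rV[R]_d * 'rV[R]_d) : R :=
  s^-1 * dotp (nu z.2) (z.1 - m z.2).

Local Notation q := path_density.
Local Notation Z := path_score.

Lemma path_density_gt0 z : 0 < q z.
Proof. by rewrite mulr_gt0// gaussian_gt0. Qed.

Let measurable_comp2 d' (T : measurableType d') (f : 'rV[R]_d -> T) :
  measurable_fun setT f ->
  measurable_fun setT (fun z : 'rV[R]_d * 'rV[R]_d => f z.2).
Proof. by move=> mf; exact: (measurableT_comp mf measurable_snd). Qed.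

Lemma measurable_path_density : measurable_fun setT q.
Proof.
apply: measurable_funM; last exact: measurable_comp2.
by apply: measurable_gaussian; [exact: measurable_comp2|exact: measurable_fst].
Qed.

Lemma measurable_path_score : measurable_fun setT Z.
Proof.
apply: measurable_funM; first exact: measurable_cst.
apply: measurable_dotp; first exact: measurable_comp2.
by apply: measurable_rVB; [exact: measurable_fst|exact: measurable_comp2].
Qed.

(** Integrating over the final position first removes the Gaussian factor and leaves [p]. *)
Lemma integrable_path_density :
  (path_measure R d).-integrable setT (EFin \o q).
Proof.
apply/integrable21ltyP.
  by apply/measurable_EFinP; exact: measurable_path_density.
have -> : (fun y => \int[lebesgue_rV R d]_x `|(EFin \o q) (x, y)|)%E =
    (fun y => `|(p y)%:E|)%E.
  apply/funext => y.
  under eq_integral do rewrite /= ger0_norm ?(ltW (path_density_gt0 _))// /q/=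
    mulrC EFinM.
  rewrite integralZl//; last exact: integrable_gaussian.
  by rewrite integral_gaussian// mule1 /= ger0_norm ?ltW.
by have /integrableP[_] := ip.
Qed.

(** The inner integral over the final position is [s^-2 p] times the second moment [s |nu|^2]. Being
    an equality of extended reals, it also shows that the second moment of the score is finite. *)
Lemma integral_path_score_sqr : (\int[path_measure R d]_z (q z * Z z ^+ 2)%:E =
  (s^-1 * \int[lebesgue_rV R d]_x (dotp (nu x) (nu x) * p x))%:E)%E.
Proof.
rewrite fubini_tonelli2; last 2 first.
- apply/measurable_EFinP/measurable_funM; first exact: measurable_path_density.
  by apply: measurable_funX; exact: measurable_path_score.
- by move=> z; rewrite lee_fin mulr_ge0 ?sqr_ge0 ?(ltW (path_density_gt0 _)).
rewrite /fubini_G -RintegralZl// /Rintegral fineK; last first.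
  by apply: integrable_fin_num => //; exact: integrableZl inu.
apply: eq_integral => y _.
rewrite (_ : (fun x => _) = (fun x => (s ^- 2 * p y)%:E *
    (dotp (nu y) (x - m y) ^+ 2 * gaussian s (m y) x)%:E)%E); last first.
  by apply/funext => x; rewrite -EFinM /q /Z/=; congr _%:E; field; rewrite gt_eqF.
rewrite ge0_integralZl//.
- by rewrite gaussian_dotp_sqr// -EFinM; congr _%:E; field; rewrite gt_eqF.
- apply/measurable_EFinP/measurable_funM.
    apply: measurable_funX; apply: measurable_dotp => //.
    exact: measurable_rVB.
  exact: measurable_gaussian.
- by move=> x _; rewrite lee_fin mulr_ge0 ?sqr_ge0 ?(ltW (gaussian_gt0 _ _ s0)).
- by rewrite lee_fin mulr_ge0 ?(ltW (p0 y))// invr_ge0 sqr_ge0.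
Qed.

Lemma integrable_path_score_sqr :
  (path_measure R d).-integrable setT (EFin \o (fun z => q z * Z z ^+ 2)).
Proof.
apply/integrableP; split.
  apply/measurable_EFinP/measurable_funM; first exact: measurable_path_density.
  by apply: measurable_funX; exact: measurable_path_score.
have qZ0 z : 0 <= q z * Z z ^+ 2.
  by rewrite mulr_ge0 ?sqr_ge0 ?(ltW (path_density_gt0 _)).
under eq_integral do rewrite /= (ger0_norm (qZ0 _)).
by rewrite integral_path_score_sqr ltry.
Qed.

End gaussian_path.

(** Domination through [|a b| <= a^2 + b^2]: square integrability of both factors under the weight
    [w] makes their correlation integrable. *)
Lemma integrable_le_sqr d (T : measurableType d) (R : realType)
    (mu : {measure set T -> \bar R}) (w a b : T -> R) :
  measurable_fun setT w -> measurable_fun setT a -> measurable_fun setT b ->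
  (forall t, 0 <= w t) ->
  mu.-integrable setT (EFin \o (fun t => w t * a t ^+ 2)) ->
  mu.-integrable setT (EFin \o (fun t => w t * b t ^+ 2)) ->
  mu.-integrable setT (EFin \o (fun t => w t * a t * b t)).
Proof.
move=> mw ma mb w0 ia ib.
apply: (le_integrable measurableT _ _ (integrableD measurableT ia ib)).
  by apply/measurable_EFinP; do 2 apply: measurable_funM => //.
move=> t _; rewrite /= lee_fin -mulrDr normrM [leRHS]ger0_norm; last first.
  by rewrite mulr_ge0// addr_ge0// sqr_ge0.
rewrite normrM (ger0_norm (w0 t)) -mulrA ler_wpM2l// -(real_normK (num_real (a t))).
rewrite -(real_normK (num_real (b t))).
have := sqr_ge0 (`|a t| - `|b t|); have := sqr_ge0 (`|a t| + `|b t|); lra.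
Qed.

(** * Integration by parts against a Gaussian density *)

Lemma C1_continuous (R : realType) (n : nat) (f : 'rV[R]_n -> R) :
  C1 f -> continuous f.
Proof. by move=> [df _] x; exact: differentiable_continuous. Qed.

Lemma C1_is_derive (R : realType) (n : nat) (f : 'rV[R]_n -> R) x i :
  C1 f -> is_derive x (delta_mx ord0 i) f (grad f x ord0 i).
Proof.
move=> [df _]; split; first exact: diff_derivable.
by rewrite mxE.
Qed.

Lemma C1_continuous_grad (R : realType) (n : nat) (f : 'rV[R]_n -> R) i :
  C1 f -> continuous (fun x => grad f x ord0 i).
Proof.
move=> [_ cf] x; apply: (@continuous_comp _ _ _ (grad f) (fun y => y ord0 i)).
  exact: cf.
exact: coord_continuous.
Qed.

Lemma grad_cst (R : realType) (n : nat) (a : R) (x : 'rV[R]_n) :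
  grad (fun=> a) x = 0.
Proof. by apply/rowP => i; rewrite !mxE; exact: derive_cst. Qed.

Section gaussian_integration_by_parts.
Variables (R : realType) (n : nat) (s : R) (m : 'rV[R]_n) (f : 'rV[R]_n -> R).
Hypotheses (s0 : 0 < s) (f1 : C1 f).
Hypothesis f_sqr : (lebesgue_rV R n).-integrable setT
  (EFin \o (fun x => gaussian s m x * f x ^+ 2)).

(** This is the part of the derivative of [gaussian * f] that comes from the Gaussian, up to the
    factor [- s^-1]. It is a correlation of two functions that are square integrable under the
    Gaussian. *)
Lemma integrable_gaussian_coordM i : (lebesgue_rV R n).-integrable setT
  (EFin \o (fun x => gaussian s m x * f x * (x - m) ord0 i)).
Proof.
apply: integrable_le_sqr => //.
- by apply: continuous_measurable_rV; exact: continuous_gaussian.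
- by apply: continuous_measurable_rV; exact: C1_continuous.
- by apply: continuous_measurable_rV; exact: continuous_coordB.
- by move=> x; rewrite ltW// gaussian_gt0.
- have : (lebesgue_rV R n).-integrable setT
    (EFin \o (fun x => ((x - m) ord0 i ^+ 2) * gaussian s m x)).
    apply: (@integrable_gaussianM _ _ s m _ 1) => //.
      apply: measurable_funX; apply: continuous_measurable_rV.
      exact: continuous_coordB.
    move=> x; rewrite mul1r normrX -[leLHS]add0r lerD//.
    by rewrite ler_pXn2r ?nnegrE ?sqrtr_ge0// normr_coord_le.
  by apply: eq_integrable => // x _ /=; rewrite mulrC.
Qed.

Lemma gaussian_integration_by_parts i :
  vanishes_at_infinity (fun x => gaussian s m x * f x) ->
  (lebesgue_rV R n).-integrable setT
    (EFin \o (fun x => gaussian s m x * grad f x ord0 i)) ->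
  \int[lebesgue_rV R n]_x (gaussian s m x * grad f x ord0 i) =
  s^-1 * \int[lebesgue_rV R n]_x (gaussian s m x * f x * (x - m) ord0 i).
Proof.
move=> f0 fi; have i1 := integrable_gaussian_coordM i.
have i2 : (lebesgue_rV R n).-integrable setT (EFin \o (fun x =>
    s^-1 * (gaussian s m x * f x * (x - m) ord0 i))).
  exact: integrableZl i1.
have : \int[lebesgue_rV R n]_x (gaussian s m x * grad f x ord0 i -
    s^-1 * (gaussian s m x * f x * (x - m) ord0 i)) = 0.
  rewrite /Rintegral; apply: (congr1 fine (y := 0%E)).
  apply: (@integral_partial_derivative _ _ (gaussian s m * f) _ i) => //.
  - move=> x; have d1 := is_derive_gaussian m x i s0.
    have d2 := C1_is_derive x i f1.
    apply: is_derive_eq; rewrite /GRing.scale/=; ring.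
  - move=> x; apply: (@continuousB _ _ _ (fun x => gaussian s m x * grad f x ord0 i)).
      apply: continuousM; first exact: continuous_gaussian.
      exact: C1_continuous_grad.
    apply: continuousM; first exact: cst_continuous.
    apply: continuousM; last exact: continuous_coordB.
    by apply: continuousM; [exact: continuous_gaussian|exact: C1_continuous].
  - exact: integrableB fi i2.
rewrite RintegralB// (@RintegralZl _ _ _ _ _ _ s^-1)// => /eqP.
by rewrite subr_eq0 => /eqP.
Qed.

End gaussian_integration_by_parts.

(** * The current as a correlation with the score *)

Section gaussian_path_current.
Variables (R : realType) (d : nat) (s : R).
Variables (m nu : 'rV[R]_d -> 'rV[R]_d) (p : 'rV[R]_d -> R).
Hypotheses (s0 : 0 < s) (mm : measurable_fun setT m) (mnu : measurable_fun setT nu).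
Hypotheses (p0 : forall x, 0 < p x).
Hypotheses (ip : (lebesgue_rV R d).-integrable setT (EFin \o p)).
Hypotheses (inu : (lebesgue_rV R d).-integrable setT
  (EFin \o (fun x => dotp (nu x) (nu x) * p x))).
Local Notation q := (path_density s m p).
Local Notation Z := (path_score s m nu).

Variable r : 'rV[R]_d -> 'rV[R]_d -> R.
Let rz (z : 'rV[R]_d * 'rV[R]_d) := r z.1 z.2.
Let W x := rV_integral (fun x' => gaussian s (m x) x' *: grad (r^~ x) x').
Hypotheses (mr : measurable_fun setT rz)
  (ir2 : (path_measure R d).-integrable setT (EFin \o (fun z => q z * rz z ^+ 2)))
  (r1 : forall x, C1 (r^~ x))
  (r_infty : forall x, vanishes_at_infinity (fun x' => gaussian s (m x) x' * r x' x))
  (r_grad : forall x i, (lebesgue_rV R d).-integrable setT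
    (EFin \o (fun x' => gaussian s (m x) x' * grad (r^~ x) x' ord0 i)))
  (iW : (lebesgue_rV R d).-integrable setT
    (EFin \o (fun x => dotp (nu x) (W x) * p x))).

Lemma integrable_path_scoreM :
  (path_measure R d).-integrable setT (EFin \o (fun z => q z * rz z * Z z)).
Proof.
apply: integrable_le_sqr => //.
- exact: measurable_path_density.
- exact: measurable_path_score.
- by move=> z; rewrite ltW// path_density_gt0.
- exact: integrable_path_score_sqr.
Qed.

(** Fubini puts the final position inside. For almost every initial position the inner integral is a
    sum over coordinates, and each term is integrated by parts. *)
Lemma path_current : \int[lebesgue_rV R d]_x (dotp (nu x) (W x) * p x) =
  \int[path_measure R d]_z (q z * rz z * Z z).
Proof.
rewrite /Rintegral -(integral21_prod_meas1 integrable_path_scoreM).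
congr fine; apply: ae_eq_integral => //.
- exact: measurable_int iW.
- exact: measurable_fubini_G integrable_path_scoreM.
(* The second moment of the observable is finite on almost every slice, and [p y > 0] can be divided
   out; this is the square integrability under the kernel that the integration by parts asks for. *)
have := ae_integrable2 ir2; apply: filterS => y iy _.
have iy2 : (lebesgue_rV R d).-integrable setT
    (EFin \o (fun x => gaussian s (m y) x * r x y ^+ 2)).
  have := integrableZl measurableT (p y)^-1 iy; apply: eq_integrable => // x _.
  rewrite /= -EFinM /path_density /rz/=; congr _%:E; field.
  by rewrite gt_eqF.
have icoord i := integrable_gaussian_coordM (f := r^~ y) s0 (r1 y) iy2 i.
have icoordZ i : (lebesgue_rV R d).-integrable setT (EFin \o (fun x =>
    (p y * s^-1 * nu y ord0 i) *
    (gaussian s (m y) x * r x y * (x - m y) ord0 i))).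
  exact: integrableZl (icoord i).
have E x : q (x, y) * rz (x, y) * Z (x, y) = \sum_i
    ((p y * s^-1 * nu y ord0 i) *
    (gaussian s (m y) x * r x y * (x - m y) ord0 i)).
  rewrite /path_density /path_score /rz /dotp/= !mulr_sumr.
  by apply: eq_bigr => i _; ring.
rewrite /fubini_G; under eq_integral do rewrite /= E.
rewrite -[RHS]fineK; last first.
  by apply: integrable_fin_num => //; exact: integrable_sumR.
congr _%:E; rewrite [RHS]Rintegral_sum//.
rewrite /dotp mulr_suml; apply: eq_bigr => i _.
rewrite RintegralZl// /W mxE.
rewrite (@eq_Rintegral _ _ _ _ _ (fun x => gaussian s (m y) x * grad (r^~ y) x ord0 i)).
  rewrite gaussian_integration_by_parts//; ring.
by move=> x _; rewrite mxE.
Qed.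

End gaussian_path_current.

(** * The quadratic form behind the Cauchy-Schwarz inequality *)

Section gaussian_path_variance.
Variables (R : realType) (d : nat) (s : R).
Variables (m nu : 'rV[R]_d -> 'rV[R]_d) (p : 'rV[R]_d -> R).
Hypotheses (s0 : 0 < s) (mm : measurable_fun setT m) (mnu : measurable_fun setT nu).
Hypotheses (p0 : forall x, 0 < p x).
Hypotheses (ip : (lebesgue_rV R d).-integrable setT (EFin \o p)).
Hypotheses (inu : (lebesgue_rV R d).-integrable setT
  (EFin \o (fun x => dotp (nu x) (nu x) * p x))).
Local Notation q := (path_density s m p).
Local Notation Z := (path_score s m nu).

Lemma integrable_path_score :
  (path_measure R d).-integrable setT (EFin \o (fun z => q z * Z z)).
Proof.
have := @integrable_path_scoreM _ _ _ _ _ _ s0 mm mnu p0 ip inu (fun _ _ => 1).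
under [X in _ -> _ -> _.-integrable _ X]eq_fun do rewrite mulr1.
apply; first exact: measurable_cst.
under eq_fun do rewrite expr1n mulr1.
exact: integrable_path_density.
Qed.

(* [path_current] for the constant observable 1, whose gradient is zero. *)
Lemma integral_path_score : \int[path_measure R d]_z (q z * Z z) = 0.
Proof.
have W0 x : rV_integral (fun x' : 'rV[R]_d =>
    gaussian s (m x) x' *: grad (fun=> 1 : R) x') = 0.
  apply/rowP => i; rewrite mxE [RHS]mxE.
  under eq_Rintegral do rewrite grad_cst scaler0 mxE.
  by rewrite Rintegral_cst// mul0r.
have nuW0 x : dotp (nu x) (rV_integral (fun x' : 'rV[R]_d =>
    gaussian s (m x) x' *: grad (fun=> 1 : R) x')) * p x = 0.
  by rewrite W0 /dotp big1 ?mul0r// => i _; rewrite mxE mulr0.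
have := @path_current _ _ _ _ _ _ s0 mm mnu p0 ip inu (fun _ _ => 1).
under eq_Rintegral do rewrite nuW0.
rewrite Rintegral_cst// mul0r.
under [in X in _ -> _ -> _ -> _ -> _ -> _ -> _ = X]eq_Rintegral do rewrite mulr1.
move=> <- //.
- under eq_fun do rewrite expr1n mulr1.
  exact: integrable_path_density.
- move=> x; split; first by move=> y; exact: differentiable_cst.
  rewrite (_ : grad _ = cst 0); first exact: cst_continuous.
  by apply/funext => y; exact: grad_cst.
- move=> x; under eq_fun do rewrite mulrC.
  apply: (@vanishes_at_infinity_gaussianM _ _ _ _ (fun=> 1) 1) => // y.
  by rewrite normr1 mul1r lerDl sqr_ge0.
- move=> x i; under eq_fun do rewrite grad_cst mxE mulr0.
  exact: integrable0.
- under eq_fun do rewrite nuW0.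
  exact: integrable0.
Qed.

Variable r : 'rV[R]_d -> 'rV[R]_d -> R.
Let rz (z : 'rV[R]_d * 'rV[R]_d) := r z.1 z.2.
Let W x := rV_integral (fun x' => gaussian s (m x) x' *: grad (r^~ x) x').
Hypotheses (mr : measurable_fun setT rz)
  (ir : (path_measure R d).-integrable setT (EFin \o (fun z => q z * rz z)))
  (ir2 : (path_measure R d).-integrable setT (EFin \o (fun z => q z * rz z ^+ 2)))
  (r1 : forall x, C1 (r^~ x))
  (r_infty : forall x, vanishes_at_infinity (fun x' => gaussian s (m x) x' * r x' x))
  (r_grad : forall x i, (lebesgue_rV R d).-integrable setT
    (EFin \o (fun x' => gaussian s (m x) x' * grad (r^~ x) x' ord0 i)))
  (iW : (lebesgue_rV R d).-integrable setT
    (EFin \o (fun x => dotp (nu x) (W x) * p x))).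

(* For every [l], [0 <= E[((r - c) - l Z)^2] = V - 2 l J + l^2 E[Z^2]]. *)
Lemma path_variance_score (c l : R) :
  0 <= \int[path_measure R d]_z (q z * (rz z - c) ^+ 2) -
    2 * l * \int[lebesgue_rV R d]_x (dotp (nu x) (W x) * p x) +
    l ^+ 2 * (s^-1 * \int[lebesgue_rV R d]_x (dotp (nu x) (nu x) * p x)).
Proof.
have iq := integrable_path_density s0 mm p0 ip.
have iZ := integrable_path_score.
have iZ2 := integrable_path_score_sqr s0 mm mnu p0 ip inu.
have irZ := integrable_path_scoreM s0 mm mnu p0 ip inu mr ir2.
have q0 z : 0 <= q z by rewrite ltW// path_density_gt0.
have iV : (path_measure R d).-integrable setT
    (EFin \o (fun z => q z * (rz z - c) ^+ 2)).
  have i1 : (path_measure R d).-integrable setT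
      (EFin \o (fun z => (-2 * c) * (q z * rz z))).
    exact: (integrableZl measurableT _ ir).
  have i2 : (path_measure R d).-integrable setT
      (EFin \o (fun z => c ^+ 2 * q z)).
    exact: (integrableZl measurableT _ iq).
  have := integrableD measurableT (integrableD measurableT ir2 i1) i2.
  apply: eq_integrable => // z _; rewrite /= -!EFinD; congr _%:E; ring.
have i1 : (path_measure R d).-integrable setT
    (EFin \o (fun z => (2 * l) * (q z * rz z * Z z))).
  exact: (integrableZl measurableT _ irZ).
have i2 : (path_measure R d).-integrable setT
    (EFin \o (fun z => (2 * l * c) * (q z * Z z))).
  exact: (integrableZl measurableT _ iZ).
have i3 : (path_measure R d).-integrable setT
    (EFin \o (fun z => l ^+ 2 * (q z * Z z ^+ 2))).
  exact: (integrableZl measurableT _ iZ2).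
have -> : s^-1 * \int[lebesgue_rV R d]_x (dotp (nu x) (nu x) * p x) =
    \int[path_measure R d]_z (q z * Z z ^+ 2).
  by rewrite [RHS]/Rintegral (integral_path_score_sqr s0 mm mnu p0 ip inu).
have -> : \int[lebesgue_rV R d]_x (dotp (nu x) (W x) * p x) =
    \int[path_measure R d]_z (q z * rz z * Z z) by exact: path_current.
have i4 : (path_measure R d).-integrable setT (EFin \o (fun z =>
    q z * (rz z - c) ^+ 2 - (2 * l) * (q z * rz z * Z z))).
  exact: (integrableB measurableT iV i1).
have i5 : (path_measure R d).-integrable setT (EFin \o (fun z =>
    q z * (rz z - c) ^+ 2 - (2 * l) * (q z * rz z * Z z) +
    (2 * l * c) * (q z * Z z))).
  exact: (integrableD measurableT i4 i2).
have <- : \int[path_measure R d]_z (q z * ((rz z - c) - l * Z z) ^+ 2) =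
    \int[path_measure R d]_z (q z * (rz z - c) ^+ 2) -
    2 * l * \int[path_measure R d]_z (q z * rz z * Z z) +
    l ^+ 2 * \int[path_measure R d]_z (q z * Z z ^+ 2).
  rewrite -(RintegralZl _ _ irZ)// -(RintegralZl _ _ iZ2)// -RintegralB//.
  (* The centring constant [c] produces the cross term [2 l c E[Z]]. It is zero by
     [integral_path_score], and is inserted here to match the expansion of the square. *)
  rewrite -[X in _ = X + _]addr0.
  rewrite -[X in _ = _ + X + _](mulr0 (2 * l * c)) -integral_path_score.
  rewrite -(RintegralZl _ _ iZ)// -RintegralD// -RintegralD//.
  by apply: eq_Rintegral => z _; rewrite /rz; ring.
rewrite fine_ge0// integral_ge0// => z _.
by rewrite lee_fin mulr_ge0// sqr_ge0.
Qed.

End gaussian_path_variance.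

Lemma sqr_le_of_quadratic_ge0 (R : realType) (V J K : R) : 0 < V -> 0 <= K ->
  (forall l, 0 <= V - 2 * l * J + l ^+ 2 * K) -> J ^+ 2 <= V * K.
Proof.
move=> V0 K0 VJK; have [->|J0] := eqVneq J 0.
  by rewrite expr0n mulr_ge0// ltW.
(* The minimiser [J / K] would require [K] to be nonzero, whereas [V / J] only needs the case
   [J = 0] set aside. The form takes there the value [V / J^2 * (V K - J^2)]. *)
have := VJK (V / J).
rewrite [leRHS](_ : _ = V / J ^+ 2 * (V * K - J ^+ 2)); last by field.
by rewrite pmulr_rge0 ?subr_ge0// divr_gt0// exprn_even_gt0.
Qed.

(** * The Fokker-Planck dynamics *)

Lemma grad_ln (R : realType) (n : nat) (p : 'rV[R]_n -> R) x :
  C1 p -> (forall x, 0 < p x) ->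
  grad (fun y => ln (p y)) x = (p x)^-1 *: grad p x.
Proof.
move=> p1 p0; apply/rowP => i; rewrite [LHS]mxE [RHS]mxE.
apply: (@derive_val _ _ _ _ _ (fun y => ln (p y))); apply/is_derive_lineP.
have px : 0 < p (0 *: delta_mx ord0 i + x) by [].
have d1 := (is_derive_lineP _ _ _ _).2 (C1_is_derive x i p1).
have d2 := is_derive1_ln px.
have := is_derive1_comp d2 d1.
by rewrite scale0r add0r.
Qed.

Section measurable_velocity.
Variables (R : realType) (d : nat) (mu T : R).
Variables (F : 'rV[R]_d -> 'rV[R]_d) (p : 'rV[R]_d -> R).
Hypotheses (mu0 : 0 < mu) (p0 : forall x, 0 < p x) (p1 : C1 p)
  (dflux : forall x, differentiable (flux mu T F p) x).

(** The flux is differentiable, hence continuous, and the velocity is the flux divided by the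
    positive continuous density. *)
Lemma continuous_velocity_coord i :
  continuous (fun x => mean_velocity mu T F p x ord0 i).
Proof.
have -> : (fun x => mean_velocity mu T F p x ord0 i) =
    (fun x => (p x)^-1 * flux mu T F p x ord0 i).
  by apply/funext => x; rewrite [flux _ _ _ _ _ _ _]mxE mulKf// gt_eqF.
move=> x; apply: (@continuousM _ _ (fun x => (p x)^-1)).
  by apply: continuousV; [rewrite gt_eqF|exact: C1_continuous].
apply: (@continuous_comp _ _ _ (flux mu T F p) (fun y => y ord0 i)).
  exact: differentiable_continuous.
exact: coord_continuous.
Qed.

(** The definition of the mean velocity is solved for the force, the logarithmic gradient being
    [grad p / p]. *)
Lemma continuous_force_coord i : continuous (fun x => F x ord0 i).
Proof.
have -> : (fun x => F x ord0 i) = (fun x =>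
    mu^-1 * mean_velocity mu T F p x ord0 i + T * ((p x)^-1 * grad p x ord0 i)).
  apply/funext => x; rewrite /mean_velocity grad_ln//.
  by rewrite !mxE mulKf ?gt_eqF// subrK.
move=> x; apply: (@continuousD _ _ _
    (fun x => mu^-1 * mean_velocity mu T F p x ord0 i)).
  apply: (@continuousM _ _ (cst mu^-1)); first exact: cst_continuous.
  exact: continuous_velocity_coord.
apply: (@continuousM _ _ (cst T)); first exact: cst_continuous.
apply: (@continuousM _ _ (fun x => (p x)^-1)); last exact: C1_continuous_grad.
by apply: continuousV; [rewrite gt_eqF|exact: C1_continuous].
Qed.

Lemma measurable_velocity : measurable_fun setT (mean_velocity mu T F p).
Proof.
apply/measurable_fun_rVP => i; apply: continuous_measurable_rV.
exact: continuous_velocity_coord.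
Qed.

Lemma measurable_drift (h : R) : measurable_fun setT (fun x : 'rV[R]_d => x + h *: F x).
Proof.
apply/measurable_fun_rVP => i; under eq_fun do rewrite !mxE.
apply: measurable_funD; first exact: measurable_coord.
apply: measurable_funM; first exact: measurable_cst.
by apply: continuous_measurable_rV; exact: continuous_force_coord.
Qed.

End measurable_velocity.

Lemma transition_gaussian (R : realType) (d : nat) (mu T dt : R)
    (F : 'rV[R]_d -> 'rV[R]_d) :
  transition mu T F dt =
  (fun x' x => gaussian (2 * mu * T * dt) (x + (mu * dt) *: F x) x').
Proof.
apply/funext => x'; apply/funext => x; rewrite /transition /gaussian opprD addrA.
congr ((_ `^ _)^-1 * expR (- (_ / _))); ring.
Qed.

Theorem proposition8 (R : realType) (d : nat) (mu T : R)
  (mu_gt0 : 0 < mu) (T_gt0 : 0 < T)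
  (I : set R) (I_open : open I)
  (F : R -> 'rV[R]_d -> 'rV[R]_d) (P : R -> 'rV[R]_d -> R)
  (FP : fokker_planck_solution mu T I F P)
  (tau : R) (I_tau : I tau)
  (sigma_finite_tau : (lebesgue_rV R d).-integrable setT (fun x =>
     (enorm (mean_velocity mu T (F tau) (P tau) x) ^+ 2 * P tau x)%:E))
  (dt_max : R) (dt_max_gt0 : 0 < dt_max)
  (obs : R -> 'rV[R]_d -> 'rV[R]_d -> R)
  (obs_measurable : forall dt : R, 0 < dt < dt_max ->
     measurable_fun [set: 'rV[R]_d * 'rV[R]_d] (fun z => obs dt z.1 z.2))
  (obs_C1 : forall dt : R, 0 < dt < dt_max ->
     forall x, C1 (fun x' => obs dt x' x))
  (obs_infty : forall dt : R, 0 < dt < dt_max ->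
     forall x, vanishes_at_infinity (fun x' =>
       transition mu T (F tau) dt x' x * obs dt x' x))
  (obs_mean : forall dt : R, 0 < dt < dt_max ->
     (path_measure R d).-integrable setT (fun z =>
       (forward_density mu T (F tau) (P tau) dt z * obs dt z.1 z.2)%:E))
  (obs_square : forall dt : R, 0 < dt < dt_max ->
     (path_measure R d).-integrable setT (fun z =>
       (forward_density mu T (F tau) (P tau) dt z * obs dt z.1 z.2 ^+ 2)%:E))
  (obs_var_gt0 : forall dt : R, 0 < dt < dt_max ->
     0 < path_variance mu T (F tau) (P tau) dt (fun z => obs dt z.1 z.2))
  (obs_grad : forall dt : R, 0 < dt < dt_max ->
     forall x i, (lebesgue_rV R d).-integrable setT (fun x' =>
       (transition mu T (F tau) dt x' x *
        grad (fun y => obs dt y x) x' ord0 i)%:E))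
  (obs_current : forall dt : R, 0 < dt < dt_max ->
     (lebesgue_rV R d).-integrable setT (fun x =>
       (dotp (mean_velocity mu T (F tau) (P tau) x)
             (grad_average mu T (F tau) dt (obs dt) x) * P tau x)%:E)) :
  exists err : R -> R,
    (err dt / dt @[dt --> 0^'+] --> (0 : R)) /\
    forall dt : R, 0 < dt < dt_max ->
      entropy_production_rate mu T (F tau) (P tau) * dt >=
      2 * generalized_current mu T (F tau) (P tau)
            (grad_average mu T (F tau) dt (obs dt)) ^+ 2 /
      (path_variance mu T (F tau) (P tau) dt (fun z => obs dt z.1 z.2) / dt)
      * dt + err dt.
Proof.
exists (cst 0); split.
  rewrite (_ : (fun dt => _) = cst 0); first exact: cvg_cst.
  by apply/funext => dt; rewrite /= mul0r.
move=> dt dtP; rewrite addr0.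
have [[mp p0 ip1] p1 dflux _] := FP tau I_tau.
have /andP[dt0 _] := dtP.
set s : R := 2 * mu * T * dt.
have s0 : 0 < s by rewrite !mulr_gt0.
set nu := mean_velocity mu T (F tau) (P tau).
pose m x := x + (mu * dt) *: F tau x.
have mnu : measurable_fun setT nu by exact: measurable_velocity dflux.
have mm : measurable_fun setT m by exact: measurable_drift dflux _.
have ip : (lebesgue_rV R d).-integrable setT (EFin \o P tau).
  apply/integrableP; split; first exact/measurable_EFinP.
  under eq_integral do rewrite /= (ger0_norm (ltW (p0 _))).
  by rewrite ip1 ltry.
have inu : (lebesgue_rV R d).-integrable setT
    (EFin \o (fun x => dotp (nu x) (nu x) * P tau x)).
  by move: sigma_finite_tau; under eq_fun do rewrite enorm_sqr.
have qE : forward_density mu T (F tau) (P tau) dt = path_density s m (P tau).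
  by apply/funext => z; rewrite /forward_density transition_gaussian.
have := obs_mean dt dtP; have := obs_square dt dtP; rewrite qE => ir2 ir.
have := obs_infty dt dtP; have := obs_grad dt dtP; have := obs_current dt dtP.
have := obs_var_gt0 dt dtP.
rewrite /grad_average /path_variance /path_expectation qE transition_gaussian.
rewrite -/s -/nu => V0 iW r_grad r_infty.
have := path_variance_score s0 mm mnu p0 ip inu (obs_measurable dt dtP) ir ir2
  (obs_C1 dt dtP) r_infty r_grad iW.
(* Centring at the mean turns the first term of the quadratic form into the variance. *)
move=> /(_ (path_expectation mu T (F tau) (P tau) dt (fun z => obs dt z.1 z.2))).
rewrite /path_expectation qE.
rewrite /generalized_current -/nu.
set V := Rintegral _ _ _; set J := Rintegral _ _ _.
have -> : entropy_production_rate mu T (F tau) (P tau) = (mu * T)^-1 *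
    \int[lebesgue_rV R d]_x (dotp (nu x) (nu x) * P tau x).
  by congr (_ * _); apply: eq_Rintegral => x _; rewrite enorm_sqr.
set K := Rintegral _ _ _ => VJK.
have K0 : 0 <= K.
  rewrite fine_ge0// integral_ge0// => x _.
  by rewrite lee_fin mulr_ge0 ?dotp_ge0// ltW.
have {}VJK : J ^+ 2 <= V * (s^-1 * K).
  apply: sqr_le_of_quadratic_ge0 VJK; first exact: V0.
  by rewrite mulr_ge0// invr_ge0 ltW.
(* Both sides are brought to the common factor [2 dt^2 / V]; on the right, [s = 2 mu T dt] turns
   [s^-1 K] times [2 dt^2] into [K dt / (mu T)]. *)
rewrite [leLHS](_ : _ = J ^+ 2 * (2 * dt ^+ 2 / V)); last first.
  by field; rewrite !gt_eqF.
rewrite [leRHS](_ : _ = V * (s^-1 * K) * (2 * dt ^+ 2 / V)); last first.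
  by rewrite /s; field; rewrite !gt_eqF.
by rewrite ler_wpM2r// divr_ge0 ?ltW// mulr_gt0// exprn_gt0.
Qed.
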